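(* Let $\mathcal B$ be a separable complex Banach space, let $U\subset\mathbb C$ be open and connected, let $z_0\in U$, and let $A:U\to\mathcal L_{\mathcal B}$ be an analytic function such that $A(z)$ is Fredholm for every $z\in U$, invertible for every $z\in U\setminus\{z_0\}$, and not invertible at $z=z_0$. Let $A_{j,z_0}$, $P_k$, $Q_k$, $A^{[k]}$ and $d>0$ be as in the context, with $A^{[d]}(z_0)$ invertible, and suppose that $P_0=0$, $P_d\ne I$, and $P_{d+j}=I$ for $j>0$. Then, for $k=1,\ldots,d$, the Fredholm quotient of order $k$ at $z_0$ is given by $$A^{[k]}(z_0)=\sum_{j=0}^{k-1}(P_{j+1}-P_j)A_{j,z_0}+(I-P_k)A_{k,z_0},$$ and for all $0\le j,\ell\le k-1$ with $j\ne\ell$ $$(P_{j+1}-P_j)(P_{\ell+1}-P_\ell)=0\quad\text{and}\quad(P_{j+1}-P_j)(I-P_k)=0.$$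
   Context: $\mathcal L_{\mathcal B}$ is the space of bounded linear operators on $\mathcal B$ and $I$ is the identity. A projection is a bounded idempotent operator. An operator $T\in\mathcal L_{\mathcal B}$ is Fredholm if $\dim(\ker T)<\infty$ and $\dim(\operatorname{coker}T)<\infty$. The operators $A_{j,z_0}\in\mathcal L_{\mathcal B}$ are the Taylor coefficients of $A$ at $z_0$: $A(z)=\sum_{j=0}^\infty A_{j,z_0}(z-z_0)^j$. Successive factorization: starting from $A^{[0]}=A$, for $k=1,2,\ldots$ let $P_k$ be a projection with $\operatorname{ran}P_k=\operatorname{ran}A^{[k-1]}(z_0)$ (no other requirement is imposed on $P_k$; in particular its kernel may be any convenient choice), let $Q_k=I-P_k$, and let $A^{[k]}$, called the Fredholm quotient of order $k$, be the analytic function on $U$, with values Fredholm operators of index zero, satisfying $A^{[k-1]}(z)=(P_k+(z-z_0)Q_k)A^{[k]}(z)$ for $z\in U$ (so $A^{[k]}(z)=(P_k+(z-z_0)^{-1}Q_k)A^{[k-1]}(z)$ for $z\ne z_0$, extended analytically to $z_0$). The integer $d>0$ is such that $A(z)=(P_1+(z-z_0)Q_1)\cdots(P_d+(z-z_0)Q_d)A^{[d]}(z)$ with $A^{[d]}$ analytic and $A^{[d]}(z_0)$ invertible; then $\operatorname{ran}P_1\subset\cdots\subset\operatorname{ran}P_d$.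
   Formalization: The inclusions ran P_1 ⊂ … ⊂ ran P_d are assumed. The product relations with j<ℓ and those with I−P_k are proved only if ker P_k ⊂ … ⊂ ker P_1, as they fail for arbitrary kernels; the formula and the relations with ℓ<j need no kernel condition. *)

(* Defs.v *)
From HB Require Import structures.
From mathcomp Require Import all_boot all_order all_algebra.
From mathcomp Require Import all_classical all_reals all_analysis.
From mathcomp Require Import complex.

Set Implicit Arguments.
Unset Strict Implicit.
Unset Printing Implicit Defensive.

Import Order.TTheory GRing.Theory Num.Theory.
Import numFieldNormedType.Exports.

Local Open Scope classical_set_scope.
Local Open Scope complex_scope.
Local Open Scope ring_scope.

(* R[i], named so that it inherits the normed-field topology that
   MathComp-Analysis puts on the carrier of every numFieldType. *)
Definition Cplx (R : realType) : numClosedFieldType := R[i].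

Definition op_bound (R : realType) (B : normedModType (Cplx R)) (f : B -> B)
  (r : R) : Prop := 0 <= r /\ forall x, `|f x| <= r%:C * `|x|.

Definition bounded_linear (R : realType) (B : normedModType (Cplx R)) :
  {pred B -> B} := [pred f | `[< linear f /\ exists r, op_bound f r >]].

Record bounded_op (R : realType) (B : normedModType (Cplx R)) := BoundedOp {
  op_fun :> B -> B;
  op_funP : op_fun \in @bounded_linear R B }.

Section bounded_op_structure.
Variables (R : realType) (B : normedModType (Cplx R)).
Local Notation L := (bounded_op B).
Implicit Types (S T : L) (f g : B -> B).

HB.instance Definition _ := [isSub for @op_fun R B].
HB.instance Definition _ := gen_eqMixin L.
HB.instance Definition _ := [Choice of L by <:].

Lemma bounded_linearP f :
  reflect (linear f /\ exists r, op_bound f r) (f \in @bounded_linear R B).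
Proof. exact: asboolP. Qed.

Lemma op_bound_scale (c : (Cplx R)) f r : op_bound f r ->
  op_bound (c *: f) (complex.Re `|c| * r).
Proof.
have c0 : (complex.Re `|c|)%:C = `|c| by rewrite RRe_real ?normr_real.
move=> [r0 fr]; split; first by rewrite mulr_ge0// -ler0c c0.
move=> x; rewrite -[(c *: f) x]/(c *: f x) normrZ rmorphM/= c0 -mulrA.
by rewrite ler_wpM2l.
Qed.

Lemma op_bound_add f g r s : op_bound f r -> op_bound g s ->
  op_bound (f + g) (r + s).
Proof.
move=> [r0 fr] [s0 gs]; split; first exact: addr_ge0.
move=> x; rewrite -[(f + g) x]/(f x + g x) rmorphD/= mulrDl.
by rewrite (le_trans (ler_normD _ _))// lerD.
Qed.

Fact bounded_linear_submod : submod_closed (@bounded_linear R B).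
Proof.
split.
  apply/bounded_linearP; split; first by move=> a x y; rewrite /= scaler0 addr0.
  by exists 0; split => // x; rewrite normr0 mul0r.
move=> a f g /bounded_linearP[lf [r fr]] /bounded_linearP[lg [s gs]].
apply/bounded_linearP; split.
  move=> c x y; rewrite -[LHS]/(a *: f (c *: x + y) + g (c *: x + y)) lf lg.
  rewrite -[RHS]/(c *: (a *: f x + g x) + (a *: f y + g y)).
  by rewrite !scalerDr !scalerA (mulrC a) addrACA.
by exists (complex.Re `|a| * r + s); apply: op_bound_add => //; exact: op_bound_scale.
Qed.
HB.instance Definition _ := GRing.isSubmodClosed.Build _ _
  (@bounded_linear R B) bounded_linear_submod.
HB.instance Definition _ := [SubChoice_isSubLmodule of L by <:].

Lemma op_linear T : linear T.
Proof. by have /bounded_linearP[] := op_funP T. Qed.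
HB.instance Definition _ T :=
  GRing.isLinear.Build (Cplx R) B B *:%R (op_fun T) (op_linear T).

Lemma op_ext S T : S =1 T -> S = T.
Proof. by move=> ST; apply: val_inj; apply/funext. Qed.

Lemma op_addE S T x : (S + T) x = S x + T x. Proof. by []. Qed.
Lemma op_oppE T x : (- T) x = - T x. Proof. by []. Qed.
Lemma op_scaleE c T x : (c *: T) x = c *: T x. Proof. by []. Qed.
Lemma op_zeroE x : (0 : L) x = 0. Proof. by []. Qed.

Fact op_id_subproof : idfun \in @bounded_linear R B.
Proof.
apply/bounded_linearP; split => //; exists 1; split => // x.
by rewrite mul1r.
Qed.
Definition op_id : L := BoundedOp op_id_subproof.

Fact op_comp_subproof S T : S \o T \in @bounded_linear R B.
Proof.
have /bounded_linearP[_ [r [r0 Sr]]] := op_funP S.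
have /bounded_linearP[_ [s [s0 Ts]]] := op_funP T.
apply/bounded_linearP; split; first by move=> a x y /=; rewrite !linearP.
exists (r * s); split => [|x]; first exact: mulr_ge0.
rewrite /= (le_trans (Sr _))// rmorphM/= -mulrA ler_wpM2l// ler0c.
by [].
Qed.
Definition op_comp S T : L := BoundedOp (op_comp_subproof S T).

Fact op_compA : associative op_comp. Proof. by move=> *; exact: op_ext. Qed.
Fact op_comp1l : left_id op_id op_comp. Proof. by move=> *; exact: op_ext. Qed.
Fact op_comp1r : right_id op_id op_comp. Proof. by move=> *; exact: op_ext. Qed.
Fact op_compDl : left_distributive op_comp +%R.
Proof. by move=> *; exact: op_ext. Qed.
Fact op_compDr : right_distributive op_comp +%R.
Proof. by move=> S T T'; apply: op_ext => x /=; rewrite linearD. Qed.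

(* 1 is the identity and * is composition; not an nzRingType, as B may be 0. *)
HB.instance Definition _ := GRing.Zmodule_isPzRing.Build L
  op_compA op_comp1l op_comp1r op_compDl op_compDr.

Lemma op_oneE x : (1 : L) x = x. Proof. by []. Qed.
Lemma op_mulE S T x : (S * T) x = S (T x). Proof. by []. Qed.

Definition opnorm T : R := inf [set r | op_bound T r].

Lemma opnorm_has_inf T : has_inf [set r | op_bound T r].
Proof.
split; last by exists 0 => r [].
by have /bounded_linearP[_] := op_funP T.
Qed.

Lemma opnorm_ge0 T : 0 <= opnorm T.
Proof. by apply: lb_le_inf => [|r []//]; have [] := opnorm_has_inf T. Qed.

Lemma opnorm_le T r : op_bound T r -> opnorm T <= r.
Proof. by move=> Tr; apply: ge_inf => //; have [] := opnorm_has_inf T. Qed.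

Lemma opnormP T : op_bound T (opnorm T).
Proof.
split; first exact: opnorm_ge0.
move=> x; have nE (y : B) : (complex.Re `|y|)%:C = `|y| by rewrite RRe_real ?normr_real.
have [->|x0] := eqVneq x 0; first by rewrite linear0 !normr0 mulr0.
have Rx0 : 0 < complex.Re `|x| by rewrite -ltcR nE normr_gt0.
rewrite -[`|T x|]nE -[`|x|]nE -rmorphM/= lecR -ler_pdivrMr//.
apply: lb_le_inf; first by have [] := opnorm_has_inf T.
by move=> r [_ /(_ x)]; rewrite ler_pdivrMr// -lecR rmorphM/= !nE.
Qed.

Fact opnormD S T : (opnorm (S + T))%:C <= (opnorm S)%:C + (opnorm T)%:C.
Proof.
by rewrite -rmorphD/= lecR opnorm_le//; apply: op_bound_add; exact: opnormP.
Qed.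

Fact opnormZ (c : (Cplx R)) T : (opnorm (c *: T))%:C = `|c| * (opnorm T)%:C.
Proof.
have cE (a : (Cplx R)) : (complex.Re `|a|)%:C = `|a| by rewrite RRe_real ?normr_real.
have le a S : opnorm (a *: S) <= complex.Re `|a| * opnorm S.
  by apply: opnorm_le; apply: op_bound_scale; exact: opnormP.
rewrite -cE -rmorphM; congr (_%:C); apply/eqP; rewrite eq_le le andTb.
have [->|c0] := eqVneq c 0; first by rewrite normr0 mul0r opnorm_ge0.
have Rc0 : 0 < complex.Re `|c| by rewrite -ltcR cE normr_gt0.
rewrite -ler_pdivlMl// (le_trans _ (le_trans (le c^-1 (c *: T)) _))//.
  by rewrite scalerA mulVf// scale1r.
by rewrite le_eqVlt; apply/orP; left; apply/eqP; congr (_ * _);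
  apply: (@complexI R); rewrite cE normfV fmorphV/= cE.
Qed.

Fact opnorm_eq0 T : (opnorm T)%:C = 0 -> T = 0.
Proof.
move=> T0; apply: op_ext => x; apply/eqP; rewrite -normr_le0.
by have [_ /(_ x)] := opnormP T; rewrite T0 mul0r.
Qed.

(* Norms over Cplx R are Cplx R-valued, whence the embedding _%:C. *)
HB.instance Definition _ := Lmodule_isNormed.Build (Cplx R) L
  opnormD opnormZ opnorm_eq0.

Lemma op_normE T : `|T| = (opnorm T)%:C. Proof. by []. Qed.

End bounded_op_structure.

Definition separable (T : topologicalType) : Prop :=
  exists2 D : set T, countable D & dense D.

Section fredholm.
Variables (R : realType) (B : normedModType (Cplx R)).
Implicit Types T : bounded_op B.

(* For subspaces W `<=` V: the quotient V/W has dimension n, i.e. the classes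
   modulo W of some n vectors of V form a basis of V/W. *)
Definition quot_dim (V W : set B) (n : nat) : Prop :=
  exists b : 'I_n -> B, (forall i, V (b i)) /\
    forall x, V x -> exists! c : 'rV[Cplx R]_n, W (x - \sum_i c 0 i *: b i).

Definition op_ker T : set B := [set x | T x = 0].

Definition dim_ker T (n : nat) : Prop := quot_dim (op_ker T) [set 0] n.
Definition dim_coker T (n : nat) : Prop := quot_dim setT (range T) n.

Definition fredholm T : Prop :=
  (exists m, dim_ker T m) /\ (exists n, dim_coker T n).

Definition fredholm_index T (i : int) : Prop :=
  exists m n : nat, [/\ dim_ker T m, dim_coker T n & i = m%:Z - n%:Z].

Definition invertible T : Prop := exists S, S * T = 1 /\ T * S = 1.

Definition projection T : Prop := T * T = T.

End fredholm.

Section analytic.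
Variables (R : realType) (V : normedModType (Cplx R)).
Implicit Type F : Cplx R -> V.

Definition taylor_at F (w : Cplx R) (a : nat -> V) : Prop :=
  \forall z \near w, series (fun n => (z - w) ^+ n *: a n) @ \oo --> F z.

Definition analytic_on (U : set (Cplx R)) F : Prop :=
  forall w, U w -> exists a, taylor_at F w a.

End analytic.

(* AA k is the Fredholm quotient A^[k]; functions on U are represented by
   functions on Cplx R whose values outside U are irrelevant. *)
Record successive_factorization (R : realType) (B : normedModType (Cplx R))
    (U : set (Cplx R)) (z0 : Cplx R) (A : Cplx R -> bounded_op B) (d : nat)
    (P : nat -> bounded_op B) (AA : nat -> Cplx R -> bounded_op B) : Prop := {
  sf_init : forall z, U z -> AA 0 z = A z;
  sf_proj : forall k, (0 < k <= d)%N ->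
    projection (P k) /\ range (P k) = range (AA k.-1 z0);
  sf_analytic : forall k, (0 < k <= d)%N -> analytic_on U (AA k);
  sf_index : forall k z, (0 < k <= d)%N -> U z -> fredholm_index (AA k z) 0;
  sf_factor : forall k z, (0 < k <= d)%N -> U z ->
    AA k.-1 z = (P k + (z - z0) *: (1 - P k)) * AA k z }.

(* Main.v *)
Require Import Defs.
From HB Require Import structures.
From mathcomp Require Import all_boot all_order all_algebra.
From mathcomp Require Import all_classical all_reals all_analysis.
From mathcomp Require Import complex.
From mathcomp Require Import zify ring.

Import Order.TTheory GRing.Theory Num.Theory.
Import numFieldNormedType.Exports.

Local Open Scope classical_set_scope.
Local Open Scope ring_scope.

(** The Fredholm quotients are computed through their whole Taylor expansions
    at [z0], not only through their values there. Let [b] be the coefficients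
    of a function [G] and [a] those of [F = (P + (z - z0) (1 - P)) G], with
    [P] idempotent. Multiplying on the left by [P] and by [1 - P] separates
    the two terms: [P F = P G] and [(1 - P) F = (z - z0) (1 - P) G]. Power
    series have unique coefficients, so [P a_n = P b_n] and
    [(1 - P) a_(n+1) = (1 - P) b_n], whose sum is the recursion
    [b_n = P a_n + (1 - P) a_(n+1)] ([taylor_factor]).

    Starting from the coefficients of [A], this recursion gives by induction
    on [k] the coefficients of the [k]-th quotient:
      [sum_(j < k) (P_(j+1) - P_j) a_(n+j) + (1 - P_k) a_(n+k)].
    The induction step ([quotient_step]) is pure ring algebra; all it uses of
    the projections is [P_j P_l = P_l] for [l <= j], which expresses that
    their ranges increase. The case [n = 0] is the announced formula.

    The same relation kills the products of increments
    [(P_(j+1) - P_j) (P_(l+1) - P_l)] with [l < j]. For [j < l], and for the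
    products with [1 - P_k], the mirror relation [P_l P_j = P_l] is required;
    it holds when the kernels decrease, for then [x - P_j x], which lies in
    the kernel of [P_j], is also killed by [P_l]. *)

(** * Uniqueness of power series coefficients *)

Lemma sum_half_le2 (K : numFieldType) (n : nat) :
  \sum_(i < n) (2^-1 : K) ^+ i <= 2.
Proof.
suff -> : \sum_(i < n) (2^-1 : K) ^+ i = 2 - 2 * 2^-1 ^+ n.
  by rewrite gerBl mulr_ge0 ?exprn_ge0 ?invr_ge0.
elim: n => [|n IHn]; first by rewrite big_ord0 expr0 mulr1 subrr.
by rewrite big_ord_recr /= IHn exprS mulrA divff ?pnatr_eq0// mul1r mulr_natl mulr2n
   opprD addrA addrNK.
Qed.

(** Boundedness of the terms at one point [x] makes the series without its
    constant term [O(|y|)] for [y] well inside the disc of radius [|x|],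
    uniformly in the number of terms. Bounding partial sums by a finite
    geometric sum avoids any completeness of [V]. *)
Lemma pseries_tail_bound (K : numFieldType) (V : normedModType K)
    (c : nat -> V) (x y : K) (M : K) (n : nat) :
  x != 0 -> (forall i, `|x ^+ i *: c i| <= M) -> `|y| <= `|x| / 2 ->
  `|series (fun i => y ^+ i *: c i) n.+1 - c 0%N| <= `|y| * (M / `|x| * 2).
Proof.
move=> x0 cM yx.
have nx0 : 0 < `|x| by rewrite normr_gt0.
have M0 : 0 <= M by rewrite (le_trans (normr_ge0 _) (cM 0%N)).
have cB i : `|c i| <= M / `|x| ^+ i.
  by rewrite ler_pdivlMr ?exprn_gt0// mulrC -normrX -normrZ.
rewrite seriesEnat /= big_nat_recl//= expr0 scale1r addrC addKr big_mkord.
apply: (le_trans (ler_norm_sum _ _ _)).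
rewrite mulrA; apply: (le_trans (y := `|y| * (M / `|x|) * \sum_(i < n) 2^-1 ^+ i)).
  rewrite mulr_sumr; apply: ler_sum => i _.
  rewrite normrZ normrX exprS -!mulrA ler_wpM2l//.
  apply: (le_trans (y := (`|x| / 2) ^+ i * (M / `|x| ^+ i.+1))).
    by apply: ler_pM; rewrite ?exprn_ge0// lerXn2r// nnegrE ?mulr_ge0// invr_ge0.
  have xi0 : `|x| ^+ i != 0 by rewrite expf_neq0 ?gt_eqF.
  rewrite exprMn exprS (_ : _ * (M / _) = M * (`|x|^-1 * 2^-1 ^+ i))//.
  by field; rewrite xi0 gt_eqF.
by rewrite ler_wpM2l ?sum_half_le2// !mulr_ge0// invr_ge0.
Qed.

(** The partial sums of the series are within [O(|z - w|)] of [c 0]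
    and tend to [0], so letting [z] tend to [w] forces [c 0 = 0]. *)
Lemma pseries_coef0_eq0 (K : numFieldType) (V : normedModType K)
    (w : K) (c : nat -> V) :
  (\forall z \near w^',
     series (fun n => (z - w) ^+ n *: c n) @ \oo --> (0 : V)) ->
  c 0%N = 0.
Proof.
move=> c0.
have [x [xc xw]] : exists x, (series (fun n => (x - w) ^+ n *: c n) @ \oo
    --> (0 : V)) /\ x != w.
  by apply: (@filter_ex _ w^' _ _); near=> z; split; near: z => //; exact: nbhs_dnbhs_neq.
have x0 : x - w != 0 by rewrite subr_eq0.
have tb : cvgn (fun n => (x - w) ^+ n *: c n).
  apply/cvg_ex; exists (0 : V) => /=.
  apply: cvg_series_cvg_0; apply/cvg_ex; by exists 0.
have [M cM] : exists M, forall i, `|(x - w) ^+ i *: c i| <= M.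
  have /pinfty_ex_gt0[M _ bM] := cvg_seq_bounded tb.
  by exists M => i; exact: bM.
pose C := M / `|x - w| * 2.
have C0 : 0 <= C.
  by rewrite !mulr_ge0 ?invr_ge0// (le_trans (normr_ge0 _) (cM 0%N)).
apply/eqP; rewrite -normr_le0; apply/ler_addgt0Pr => e e0; rewrite add0r.
have d0 : 0 < e / 2 / (C + 1) by rewrite !divr_gt0// ltr_wpDl.
have h0 : 0 < `|x - w| / 2 by rewrite divr_gt0// normr_gt0.
have nearw r : 0 < r -> \forall z \near w^', `|z - w| < r.
  move=> r0; near=> z; rewrite distrC; near: z.
  by apply: filterS (dnbhs_ball w r0) => z [].
have [y [yc [yx yC]]] : exists y, (series (fun n => (y - w) ^+ n *: c n) @ \oo
    --> (0 : V)) /\ `|y - w| <= `|x - w| / 2 /\ `|y - w| * C <= e / 2.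
  apply: (@filter_ex _ w^' _ _); near=> z; split; [|split].
  - by near: z.
  - by apply: ltW; near: z; exact: nearw.
  have zC : `|z - w| <= e / 2 / (C + 1) by apply: ltW; near: z; exact: nearw.
  apply: le_trans (ler_wpM2r C0 zC) _.
  rewrite mulrAC ler_pdivrMr ?ltr_wpDl// ler_wpM2l ?lerDl// divr_ge0// ltW//.
have [n yn] : exists n, `|series (fun i => (y - w) ^+ i *: c i) n.+1| < e / 2.
  have /cvgr0_norm_lt/(_ (e / 2)) := yc.
  move=> /(_ (divr_gt0 e0 (ltr0Sn _ 1)))[N _ Nle].
  by exists N; apply: Nle => /=.
have tn := pseries_tail_bound _ _ _ _ _ _ n x0 cM yx.
rewrite -(subKr (series (fun i => (y - w) ^+ i *: c i) n.+1) (c 0%N)).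
by rewrite (le_trans (ler_normB _ _))// [e]splitr lerD ?(ltW yn)// (le_trans tn).
Unshelve. all: by end_near. Qed.

(** The punctured neighbourhood makes the induction go through: once [c 0]
    vanishes, the series may be divided by [z - w], which says nothing
    at [w] itself. *)
Lemma pseries_coef_eq0 (K : numFieldType) (V : normedModType K)
    (w : K) (c : nat -> V) :
  (\forall z \near w^',
     series (fun n => (z - w) ^+ n *: c n) @ \oo --> (0 : V)) ->
  forall n, c n = 0.
Proof.
move=> c0 n; elim: n c c0 => [|n IHn] c cz; first exact: pseries_coef0_eq0 _ _ _ _ cz.
have c00 := pseries_coef0_eq0 _ _ _ _ cz.
apply: (IHn (fun i => c i.+1)); near=> z.
have zw : z - w != 0 by rewrite subr_eq0; near: z; exact: nbhs_dnbhs_neq.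
have zc : series (fun n => (z - w) ^+ n *: c n) @ \oo --> (0 : V) by near: z.
have <- : (z - w)^-1 *: (0 : V) = 0 by exact: scaler0.
rewrite (_ : series _ = fun n => (z - w)^-1 *:
    series (fun n => (z - w) ^+ n *: c n) n.+1); last first.
  apply/funext => m; rewrite !seriesEnat /= big_nat_recl// c00 scaler0 add0r.
  by rewrite scaler_sumr; apply: eq_bigr => i _; rewrite scalerA exprS mulKf.
apply: cvgZl_tmp; by rewrite (cvg_shiftS (series _)).
Unshelve. all: by end_near. Qed.

Lemma pseries_unique (K : numFieldType) (V : normedModType K)
    (w : K) (F : K -> V) (b c : nat -> V) :
  (\forall z \near w^', series (fun n => (z - w) ^+ n *: b n) @ \oo --> F z) ->
  (\forall z \near w^', series (fun n => (z - w) ^+ n *: c n) @ \oo --> F z) ->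
  forall n, b n = c n.
Proof.
move=> Fb Fc n; apply/eqP; rewrite -subr_eq0; apply/eqP.
apply: (pseries_coef_eq0 K V w (fun n => b n - c n)); near=> z.
rewrite -(subrr (F z)).
rewrite (_ : series _ = series (fun n => (z - w) ^+ n *: b n)
    - series (fun n => (z - w) ^+ n *: c n)); last first.
  apply/funext => m; rewrite fctE !seriesEnat /= -sumrB.
  by apply: eq_bigr => i _; rewrite scalerBr.
by apply: cvgB; near: z.
Unshelve. all: by end_near. Qed.

Lemma taylor_at_coef0 (R : realType) (V : normedModType (Cplx R))
    (F : Cplx R -> V) (w : Cplx R) (c : nat -> V) :
  taylor_at F w c -> F w = c 0%N.
Proof.
move=> /nbhs_singleton; rewrite -(cvg_shiftS (series _)) => Fw.
have Fc : series (fun n => (w - w) ^+ n *: c n) n.+1 @[n --> \oo] --> c 0%N.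
  rewrite (_ : (fun _ => _) = fun=> c 0%N); first exact: cvg_cst.
  apply/funext => m; rewrite seriesEnat /= big_nat_recl// expr0 scale1r.
  by rewrite big1 ?addr0// => i _; rewrite subrr expr0n scale0r.
exact: cvg_unique Fw Fc.
Qed.

(** * Taylor coefficients across one factorization step *)

Section coefficients.
Variables (R : realType) (B : normedModType (Cplx R)).
Implicit Types (S T P : bounded_op B) (w : Cplx R).

Lemma op_mulZr (c : Cplx R) S T : S * (c *: T) = c *: (S * T).
Proof. by apply: op_ext => x; rewrite op_mulE !op_scaleE linearZ. Qed.

Lemma op_mulZl (c : Cplx R) S T : (c *: S) * T = c *: (S * T).
Proof. by apply: op_ext. Qed.

Lemma op_normM S T : `|S * T| <= `|S| * `|T|.
Proof.
rewrite !op_normE -rmorphM /= lecR; apply: opnorm_le.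
have [S0 Sb] := opnormP S; have [T0 Tb] := opnormP T.
split=> [|x]; first exact: mulr_ge0.
rewrite op_mulE (le_trans (Sb _))// rmorphM /= -mulrA ler_wpM2l// ler0c.
exact: S0.
Qed.

Lemma op_cvgMr S (u : nat -> bounded_op B) T :
  u @ \oo --> T -> (fun n => S * u n) @ \oo --> S * T.
Proof.
move=> uT; apply/cvgrPdist_lt => e e0.
have S1 : 0 < `|S| + 1 by rewrite ltr_wpDl.
near=> n; rewrite -mulrBr (le_lt_trans (op_normM _ _))//.
have un : `|T - u n| < e / (`|S| + 1).
  near: n; apply: cvgr_dist_lt => //; exact: divr_gt0.
apply: (le_lt_trans (y := (`|S| + 1) * `|T - u n|)); last by rewrite -ltr_pdivlMl// mulrC.
by rewrite ler_wpM2r// lerDl.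
Unshelve. all: by end_near. Qed.

Lemma series_cvgMr S w (a : nat -> bounded_op B) (z : Cplx R) T :
  series (fun n => (z - w) ^+ n *: a n) @ \oo --> T ->
  series (fun n => (z - w) ^+ n *: (S * a n)) @ \oo --> S * T.
Proof.
move=> aT; rewrite (_ : series _ = fun n => S * series (fun n => (z - w) ^+ n *: a n) n);
  first exact: op_cvgMr.
apply/funext => m; rewrite !seriesEnat /= mulr_sumr.
by apply: eq_bigr => i _; rewrite op_mulZr.
Qed.

(** Applying [P] and [1 - P] separates the two components of the factor; on
    the second one, multiplication by [z - w] shifts the coefficients. *)
Lemma taylor_factor P w (F G : Cplx R -> bounded_op B) (a b : nat -> bounded_op B) :
  projection P -> taylor_at F w a -> taylor_at G w b ->
  (\forall z \near w, F z = (P + (z - w) *: (1 - P)) * G z) ->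
  forall n, b n = P * a n + (1 - P) * a n.+1.
Proof.
move=> PP Fa Gb FG n.
have PQ : P * (1 - P) = 0 by rewrite mulrBr mulr1 PP subrr.
have QP : (1 - P) * P = 0 by rewrite mulrBl mul1r PP subrr.
have QQ : (1 - P) * (1 - P) = 1 - P by rewrite mulrBr mulr1 QP subr0.
have Pab : P * a n = P * b n.
  apply: (pseries_unique _ _ w (fun z => P * F z) (fun n => P * a n)
    (fun n => P * b n)); apply: nbhs_dnbhs; near=> z.
    by apply: series_cvgMr; near: z.
  have -> : P * F z = P * G z.
    have -> : F z = (P + (z - w) *: (1 - P)) * G z by near: z.
    by rewrite mulrA mulrDr PP op_mulZr PQ scaler0 addr0.
  by apply: series_cvgMr; near: z.
have Qab : (1 - P) * a n.+1 = (1 - P) * b n.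
  (* The coefficients of (z - w) (1 - P) G: those of (1 - P) G shifted by
     one place, with a zero put first. *)
  pose c m := if m is m'.+1 then (1 - P) * b m' else 0.
  rewrite -[RHS]/(c n.+1).
  apply: (pseries_unique _ _ w (fun z => (1 - P) * F z)
    (fun n => (1 - P) * a n) c); apply: nbhs_dnbhs; near=> z.
    by apply: series_cvgMr; near: z.
  have -> : (1 - P) * F z = (z - w) *: ((1 - P) * G z).
    have -> : F z = (P + (z - w) *: (1 - P)) * G z by near: z.
    by rewrite mulrA mulrDr QP op_mulZr QQ add0r op_mulZl.
  rewrite -(cvg_shiftS (series _)).
  rewrite (_ : [sequence _]_n = fun n => (z - w) *:
      series (fun n => (z - w) ^+ n *: ((1 - P) * b n)) n); last first.
    apply/funext => m; rewrite /= !seriesEnat /= big_nat_recl// scaler0 add0r.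
    by rewrite scaler_sumr; apply: eq_bigr => i _; rewrite scalerA exprS.
  by apply: cvgZl_tmp; apply: series_cvgMr; near: z.
by rewrite Pab Qab -mulrDl addrC subrK mul1r.
Unshelve. all: by end_near. Qed.

Lemma proj_absorb_range S T : projection S -> range T `<=` range S -> S * T = T.
Proof.
move=> SS TS; apply: op_ext => x; rewrite op_mulE.
have [|y _ <-] := TS (T x); first by exists x.
by rewrite -op_mulE SS.
Qed.

Lemma proj_absorb_ker S T : projection T -> op_ker T `<=` op_ker S -> S * T = S.
Proof.
move=> TT TS; apply: op_ext => x; rewrite op_mulE; apply/eqP.
rewrite eq_sym -subr_eq0 -linearB /=; apply/eqP; apply: TS.
by rewrite /op_ker /= linearB /= -[T (T x)]/((T * T) x) TT subrr.
Qed.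

End coefficients.

(** * Algebra of increasing projections *)

Section filtration.
Variables (L : pzRingType) (p : nat -> L) (m : nat).
Hypothesis pM : forall j l, (l <= j <= m)%N -> p j * p l = p l.

Lemma increment_lt_mul0 j l : (l < j < m)%N ->
  (p j.+1 - p j) * (p l.+1 - p l) = 0.
Proof.
move=> /andP[lj jm].
by rewrite mulrBl !mulrBr !pM ?subrr//; lia.
Qed.

(** One step of the recursion [b_n = P a_n + (1 - P) a_(n+1)], in closed form.
    The factor [p k.+1] fixes the previous increments and [1 - p k.+1] kills
    them, while [1 - p k] splits into the new increment [p k.+1 - p k] and
    the new remainder [1 - p k.+1]. *)
Lemma quotient_step (a : nat -> L) n k : (k < m)%N ->
  let b i := \sum_(0 <= j < k) (p j.+1 - p j) * a (i + j)%N
             + (1 - p k) * a (i + k)%N in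
  p k.+1 * b n + (1 - p k.+1) * b n.+1 =
  \sum_(0 <= j < k.+1) (p j.+1 - p j) * a (n + j)%N
    + (1 - p k.+1) * a (n + k.+1)%N.
Proof.
move=> km b; rewrite /b !mulrDr !mulr_sumr !mulrA.
have -> : p k.+1 * (1 - p k) = p k.+1 - p k.
  by rewrite mulrBr mulr1 pM// leqnSn.
have -> : (1 - p k.+1) * (1 - p k) = 1 - p k.+1.
  by rewrite mulrBr mulr1 mulrBl mul1r pM ?leqnSn// subrr subr0.
rewrite [X in _ + (X + _)]big_nat [X in _ + (X + _)]big1 => [|j /andP[_ jk]].
  rewrite add0r big_nat_recr//= -addSnnS; congr (_ + _ + _).
  rewrite !big_nat; apply: eq_bigr => j /andP[_ jk].
  by rewrite mulrA mulrBr !pM//; lia.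
by rewrite mulrA mulrBl mul1r mulrBr !pM ?subrr ?mul0r//; lia.
Qed.

End filtration.

(** * The Fredholm quotients *)

Theorem proposition3 (R : realType) (B : completeNormedModType (Cplx R))
    (U : set (Cplx R)) (z0 : Cplx R) (A : Cplx R -> bounded_op B)
    (a : nat -> bounded_op B) (d : nat) (P : nat -> bounded_op B)
    (AA : nat -> Cplx R -> bounded_op B) :
  separable B ->
  open U -> connected U -> U z0 ->
  analytic_on U A ->
  (forall z, U z -> fredholm (A z)) ->
  (forall z, U z -> z <> z0 -> invertible (A z)) ->
  ~ invertible (A z0) ->
  taylor_at A z0 a ->
  (0 < d)%N ->
  successive_factorization U z0 A d P AA ->
  (forall z, U z ->
    A z = (\prod_(1 <= k < d.+1) (P k + (z - z0) *: (1 - P k))) * AA d z) ->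
  invertible (AA d z0) ->
  (forall k, (0 < k < d)%N -> range (P k) `<=` range (P k.+1)) ->
  P 0%N = 0 -> P d <> 1 -> (forall j, (0 < j)%N -> P (d + j)%N = 1) ->
  forall k, (0 < k <= d)%N ->
    [/\ AA k z0 = \sum_(0 <= j < k) (P j.+1 - P j) * a j + (1 - P k) * a k,
        (forall j l, (l < j < k)%N ->
          (P j.+1 - P j) * (P l.+1 - P l) = 0)
      & (forall j, (j < k)%N -> op_ker (P j.+1) `<=` op_ker (P j)) ->
          (forall j l, (j < k)%N -> (l < k)%N -> j <> l ->
            (P j.+1 - P j) * (P l.+1 - P l) = 0) /\
          (forall j, (j < k)%N -> (P j.+1 - P j) * (1 - P k) = 0)].
Proof.
move=> _ oU _ Uz0 _ _ _ _ Aa _ sf _ _ ranP P0 _ _.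
have PP j : (j <= d)%N -> projection (P j).
  case: j => [_|j jd]; first by rewrite /projection P0 mulr0.
  by have [] := sf_proj sf (k := j.+1) jd.
have ranPle j l : (0 < l <= j)%N -> (j <= d)%N -> range (P l) `<=` range (P j).
  move=> /andP[l0]; elim: j => [|j IHj]; first lia.
  rewrite leq_eqVlt => /orP[/eqP ->|lj] jd; first exact: subset_refl.
  have jP : range (P j) `<=` range (P j.+1) by apply: ranP; lia.
  by apply: subset_trans jP; apply: IHj => //; exact: ltnW.
have Pabs j l : (l <= j <= d)%N -> P j * P l = P l.
  case: l => [_|l /andP[lj jd]]; first by rewrite P0 mulr0.
  by apply: proj_absorb_range; [exact: PP|exact: ranPle].
(* At n = 0 these coefficients give the formula; the other n are needed to
   carry the induction on k. *)
have taylorAA k : (k <= d)%N -> taylor_at (AA k) z0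
    (fun n => \sum_(0 <= j < k) (P j.+1 - P j) * a (n + j)%N
              + (1 - P k) * a (n + k)%N).
  elim: k => [_|k IHk kd].
    have <- : a = fun n => \sum_(0 <= j < 0) (P j.+1 - P j) * a (n + j)%N
              + (1 - P 0%N) * a (n + 0)%N.
      by apply/funext => n; rewrite big_geq// add0r P0 subr0 mul1r addn0.
    have nU : \forall z \near z0, U z by exact: open_nbhs_nbhs.
    rewrite /taylor_at; near=> z; rewrite (sf_init sf); near: z => //.
  have [b AAb] := sf_analytic sf (k := k.+1) kd Uz0.
  have FG : \forall z \near z0,
      AA k z = (P k.+1 + (z - z0) *: (1 - P k.+1)) * AA k.+1 z.
    have nU : \forall z \near z0, U z by exact: open_nbhs_nbhs.
    by apply: filterS nU => z Uz; exact: (sf_factor sf (k := k.+1) kd Uz).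
  have bE := taylor_factor _ _ _ _ _ _ _ _ (PP _ kd) (IHk (ltnW kd)) AAb FG.
  rewrite (_ : (fun n => _) = b)//; apply/funext => n.
  by rewrite bE (quotient_step _ _ _ Pabs).
move=> k /andP[k0 kd]; split=> [|j l /andP[lj jk]|kerP].
- by rewrite (taylor_at_coef0 _ _ _ _ _ (taylorAA k kd)).
- by apply: (increment_lt_mul0 _ _ _ Pabs); lia.
have kerPle j l : (l <= j <= k)%N -> P l * P j = P l.
  move=> /andP[]; elim: j => [|j IHj]; first
    by rewrite leqn0 => /eqP ->; rewrite P0 mulr0.
  rewrite leq_eqVlt => /orP[/eqP ->|lj] jk; first by apply: (PP j.+1); lia.
  rewrite -(IHj lj (ltnW jk)) -mulrA; congr (_ * _).
  by apply: proj_absorb_ker; [apply: PP; lia|exact: kerP].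
split=> [j l jk lk jl|j jk].
  have [lj|] := ltnP l j; first by apply: (increment_lt_mul0 _ _ _ Pabs); lia.
  rewrite leq_eqVlt => /orP[/eqP //|ltjl].
  by rewrite mulrBl !mulrBr !kerPle ?subrr//; lia.
by rewrite mulrBl !mulrBr !mulr1 !kerPle ?subrr//; lia.
Unshelve. all: by end_near. Qed.
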